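(* Let $M$ be a Weingarten hyperbolic rotational surface of the second kind in $\mathbb{S}^3_1$, with profile curve parameterized by the principal curvature $\lambda$, whose principal curvatures satisfy $\kappa=\lambda+2H$ with constant $H$. Then the coordinate functions of the profile curve of $M$ with constant mean curvature $H$ in $\mathbb{S}^3_1$, parameterized with respect to $\lambda$, are given by $$w(\lambda)=\frac{c}{\sqrt{2(H+\lambda)}},\quad x(\lambda)=\sqrt{1-w^2(\lambda)}\cos\phi(\lambda),\quad y(\lambda)=\sqrt{1-w^2(\lambda)}\sin\phi(\lambda),$$ where $$\phi(\lambda)=\phi_0\pm\frac{c^2}{\sqrt2}\int\frac{\lambda\,d\lambda}{\sqrt{H+\lambda}\,(2(H+\lambda)-c^2)\sqrt{2(H+\lambda)-(\lambda^2+1)c^2}}$$ with $$\frac{1-\sqrt{1+2Hc^2-c^4}}{c^2}<\lambda<\frac{1+\sqrt{1+2Hc^2-c^4}}{c^2},$$ provided that $H>\frac12\left(c^2-\frac1{c^2}\right)$, for constants $\phi_0$ and $c>0$.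
   Context: $\mathbb{E}^4_1$ is 4-dimensional Minkowski space with metric $\tilde g(\mathbf{x},\mathbf{y})=x_1y_1+x_2y_2+x_3y_3-x_4y_4$, and $\mathbb{S}^3_1=\{\mathbf{x}\in\mathbb{E}^4_1:\tilde g(\mathbf{x},\mathbf{x})=1\}$ is de Sitter space. A hyperbolic rotational surface of the second kind is $r(u,v)=(x(u),y(u),w(u)\cosh v,w(u)\sinh v)$, $u\in J$, $v\in\mathbb{R}$, where $u$ is the arc length parameter of the profile curve, $w>0$, $x^2+y^2+w^2=1$, $x'^2+y'^2+w'^2=1$ ($'=d/du$); the induced metric is $du^2-w^2dv^2$, so it is timelike. It is assumed not contained in a hyperplane of $\mathbb{E}^4_1$, and $x',y'$ are nonzero. ''Parameterized with respect to $\lambda$'' means $\lambda$ replaces $u$ as parameter of the profile curve. Principal curvatures: with $N$ a unit normal field of the surface in $\mathbb{S}^3_1$, $\kappa=\tilde g(r_{uu},N)$ and $\lambda=\tilde g(r_{vv},N)/|\tilde g(r_v,r_v)|=\tilde g(r_{vv},N)/w^2$; the eigenvalues of the shape operator are $\kappa,-\lambda$, and the mean curvature is half its trace, $H=\frac12(\kappa-\lambda)$. Standing assumption: $\lambda$ ranges over an open interval on which $H+\lambda>0$, $2(H+\lambda)-c^2\ne0$ and $2(H+\lambda)-(\lambda^2+1)c^2>0$. The integral denotes an antiderivative in $\lambda$. *)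

(* Defs.v *)
From Stdlib Require Import Reals.
From Coquelicot Require Import Coquelicot.
Open Scope R_scope.

Definition open_interval (J : R -> Prop) : Prop :=
  exists a b : Rbar, Rbar_lt a b /\
    forall t : R, J t <-> Rbar_lt a t /\ Rbar_lt t b.

Definition smooth_on (J : R -> Prop) (f : R -> R) : Prop :=
  forall (n : nat) (t : R), J t -> ex_derive_n f n t.

Record E41 : Set := Vec { c1 : R; c2 : R; c3 : R; c4 : R }.

Definition minkowski (a b : E41) : R :=
  c1 a * c1 b + c2 a * c2 b + c3 a * c3 b - c4 a * c4 b.

Definition vDerive (f : R -> E41) (t : R) : E41 :=
  Vec (Derive (fun s => c1 (f s)) t) (Derive (fun s => c2 (f s)) t)
      (Derive (fun s => c3 (f s)) t) (Derive (fun s => c4 (f s)) t).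

Section Surface.
Variable r : R -> R -> E41.

Definition r_u (u v : R) : E41 := vDerive (fun s => r s v) u.
Definition r_v (u v : R) : E41 := vDerive (fun s => r u s) v.
Definition r_uu (u v : R) : E41 := vDerive (fun s => r_u s v) u.
Definition r_vv (u v : R) : E41 := vDerive (fun s => r_v u s) v.

(* The surface patch is [r] on [J x R].  The affine hyperplanes are the level
   sets of [minkowski a] for [a] nonzero, as the metric is nondegenerate. *)
Definition in_hyperplane (J : R -> Prop) : Prop :=
  exists (a : E41) (d : R), a <> Vec 0 0 0 0 /\
    forall u v : R, J u -> minkowski a (r u v) = d.

(* The position vector is the normal of de Sitter space, so [N] is tangent to
   de Sitter space when it is orthogonal to [r].  The surfaces considered are
   timelike, so a unit normal is spacelike.  It is determined up to sign at
   each point, so continuity already makes it as smooth as the tangent planes. *)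
Record unit_normal_field (J : R -> Prop) (N : R -> R -> E41) : Prop := {
  normal_r : forall u v, J u -> minkowski (N u v) (r u v) = 0;
  normal_u : forall u v, J u -> minkowski (N u v) (r_u u v) = 0;
  normal_v : forall u v, J u -> minkowski (N u v) (r_v u v) = 0;
  normal_unit : forall u v, J u -> minkowski (N u v) (N u v) = 1;
  normal_cont : forall u v, J u ->
    continuous (fun p : R * R => c1 (N (fst p) (snd p))) (u, v) /\
    continuous (fun p : R * R => c2 (N (fst p) (snd p))) (u, v) /\
    continuous (fun p : R * R => c3 (N (fst p) (snd p))) (u, v) /\
    continuous (fun p : R * R => c4 (N (fst p) (snd p))) (u, v) }.

Definition kappa (N : R -> R -> E41) (u v : R) : R :=
  minkowski (r_uu u v) (N u v).

Definition lambda (N : R -> R -> E41) (u v : R) : R :=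
  minkowski (r_vv u v) (N u v) / Rabs (minkowski (r_v u v) (r_v u v)).

(* The eigenvalues of the shape operator are [kappa] and [- lambda]: the sign
   comes from [r_v] being timelike. *)
Definition mean_curvature (N : R -> R -> E41) (u v : R) : R :=
  (kappa N u v + - lambda N u v) / 2.

End Surface.

Definition rot2 (x y w : R -> R) (u v : R) : E41 :=
  Vec (x u) (y u) (w u * cosh v) (w u * sinh v).

Record hyperbolic_rotational_2 (J : R -> Prop) (x y w : R -> R) : Prop := {
  rot2_J : open_interval J;
  rot2_smooth_x : smooth_on J x;
  rot2_smooth_y : smooth_on J y;
  rot2_smooth_w : smooth_on J w;
  rot2_w_pos : forall u, J u -> 0 < w u;
  rot2_sphere : forall u, J u -> x u ^ 2 + y u ^ 2 + w u ^ 2 = 1;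
  rot2_arclength : forall u, J u ->
    Derive x u ^ 2 + Derive y u ^ 2 + Derive w u ^ 2 = 1;
  rot2_dx : forall u, J u -> Derive x u <> 0;
  rot2_dy : forall u, J u -> Derive y u <> 0;
  rot2_full : ~ in_hyperplane (rot2 x y w) J }.

(* [lam : J -> I] is a change of parameter with inverse [U]: a function [f] of
   the old parameter becomes [fun l => f (U l)] on [I]. *)
Record change_of_parameter (J I : R -> Prop) (lam U : R -> R) : Prop := {
  param_I : open_interval I;
  param_smooth : smooth_on J lam;
  param_smooth_inv : smooth_on I U;
  param_to : forall u, J u -> I (lam u) /\ U (lam u) = u;
  param_from : forall l, I l -> J (U l) /\ lam (U l) = l }.

Definition phi_integrand (H c l : R) : R :=
  l / (sqrt (H + l) * (2 * (H + l) - c ^ 2) *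
       sqrt (2 * (H + l) - (l ^ 2 + 1) * c ^ 2)).

Definition antiderivative_on (I : R -> Prop) (f F : R -> R) : Prop :=
  forall l : R, I l -> is_derive F l (f l).

(* Main.v *)
(** Since [N] is a unit normal, the profile curve [p = (x, y, w)] on the unit
    sphere, its velocity [T] and the normal [n] at [v = 0] form an orthonormal
    frame of Euclidean 3-space, and [n] has last component [lambda w].  The last
    coordinate of the frame gives [w^2 + w'^2 + (lambda w)^2 = 1] and
    [w'' = - w + kappa lambda w]; eliminating [w''] yields the Codazzi equation
    [lambda' w + (lambda + kappa) w' = 0].  With [kappa = lambda + 2 H] it says
    that [2 (H + lambda) w^2] is a constant [c^2].  The angle [phi] of [(x, y)]
    satisfies [(1 - w^2) phi' = x y' - y x' = s lambda w], where the determinant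
    [s = 1] or [-1] of the frame is continuous, and [w'] has no zero by the
    Codazzi equation, so the sign in front of the integral is constant. *)

Require Import Defs.
From Stdlib Require Import Reals Lra.
From Coquelicot Require Import Coquelicot.
(* [Reals] also defines an [open_interval]; this restores the one of [Defs]. *)
Import Defs.
Open Scope R_scope.

(** * Calculus on open intervals *)

Lemma open_interval_locally (I : R -> Prop) (l : R) :
  open_interval I -> I l -> locally l I.
Proof.
  intros [a [b [_ hab]]] hl.
  apply hab in hl; destruct hl as [ha hb].
  apply (filter_imp (fun t : R => Rbar_lt a t /\ Rbar_lt t b)).
  - intros t ht; now apply hab.
  - apply filter_and.
    + apply (open_Rbar_gt' l a ha).
    + apply (open_Rbar_lt' l b hb).
Qed.

Lemma open_interval_inhabited (I : R -> Prop) :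
  open_interval I -> exists l, I l.
Proof.
  intros [a [b [hab hI]]].
  destruct a as [a| |], b as [b| |]; simpl in hab; try contradiction.
  - exists ((a + b) / 2); apply hI; simpl; lra.
  - exists (a + 1); apply hI; simpl; lra.
  - exists (b - 1); apply hI; simpl; lra.
  - exists 0; apply hI; simpl; lra.
Qed.

Lemma open_interval_between (I : R -> Prop) (l m t : R) :
  open_interval I -> I l -> I m -> l <= t <= m -> I t.
Proof.
  intros [a [b [_ hI]]] hl hm [h1 h2].
  apply hI in hl; apply hI in hm; apply hI; split.
  - apply Rbar_lt_le_trans with l; [apply hl | exact h1].
  - apply Rbar_le_lt_trans with m; [exact h2 | apply hm].
Qed.

(** Allows an identity that holds only on an open interval to be differentiated there: both sides
    agree near [l]. *)
Lemma is_derive_eq_on (I : R -> Prop) (f g : R -> R) (l df dg : R) :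
  open_interval I -> I l -> (forall t, I t -> f t = g t) ->
  is_derive f l df -> is_derive g l dg -> df = dg.
Proof.
  intros hI hl hfg hf hg.
  rewrite <- (is_derive_unique _ _ _ hf), <- (is_derive_unique _ _ _ hg).
  apply Derive_ext_loc.
  apply filter_imp with I; [exact hfg | now apply open_interval_locally].
Qed.

Lemma derive_zero_const (I : R -> Prop) (f : R -> R) (l m : R) :
  open_interval I -> (forall t, I t -> is_derive f t 0) ->
  I l -> I m -> f l = f m.
Proof.
  intros hI hf.
  assert (hlt : forall p q, I p -> I q -> p < q -> f p = f q).
  { intros p q hp hq hpq.
    apply (eq_is_derive f p q); [|exact hpq].
    intros t ht; apply hf; now apply (open_interval_between I p q). }
  intros hl hm.
  destruct (Rtotal_order l m) as [h|[h|h]].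
  - now apply hlt.
  - now subst.
  - symmetry; now apply hlt.
Qed.

(** By the intermediate value theorem a change of sign would force a zero. Recording the sign as a
    factor [eps] lets it enter algebraic identities. *)
Lemma nonvanishing_sign (I : R -> Prop) (f : R -> R) :
  open_interval I -> (forall t, I t -> continuous f t) ->
  (forall t, I t -> f t <> 0) ->
  exists eps, (eps = 1 \/ eps = -1) /\ forall t, I t -> 0 < eps * f t.
Proof.
  intros hI hc hn.
  assert (ivt : forall g p q, (forall t, I t -> continuous g t) ->
            (forall t, I t -> g t <> 0) -> I p -> I q -> p < q ->
            g p < 0 -> 0 < g q -> False).
  { intros g p q hg hg0 hp hq hpq h1 h2.
    destruct (Ranalysis5.IVT_interv g p q) as [z [hz hz0]]; auto.
    - intros t ht; apply continuity_pt_filterlim, hg.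
      now apply (open_interval_between I p q).
    - apply (hg0 z); [now apply (open_interval_between I p q) | exact hz0]. }
  assert (same : forall p q, I p -> I q -> f p < 0 -> 0 < f q -> False).
  { intros p q hp hq h1 h2.
    destruct (Rtotal_order p q) as [h|[h|h]].
    - now apply (ivt f p q).
    - subst; lra.
    (* When the positive value comes first, [- f] is the function that rises through zero. *)
    - apply (ivt (fun t => - f t) q p); auto; try lra.
      + intros t ht; apply (continuous_opp f); auto.
      + intros t ht; specialize (hn t ht); lra. }
  destruct (open_interval_inhabited I hI) as [l hl].
  destruct (Rdichotomy _ _ (hn l hl)) as [h|h].
  - exists (-1); split; [now right|].
    intros t ht; destruct (Rdichotomy _ _ (hn t ht)) as [k|k]; [lra|].
    now destruct (same l t).
  - exists 1; split; [now left|].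
    intros t ht; destruct (Rdichotomy _ _ (hn t ht)) as [k|k]; [|lra].
    now destruct (same t l).
Qed.

(** Integrates from a base point of [I]; the segment from there to any point of [I] stays inside
    [I], on either side of the base point. *)
Lemma antiderivative_exists (I : R -> Prop) (f : R -> R) :
  open_interval I -> (forall t, I t -> continuous f t) ->
  exists F, antiderivative_on I f F.
Proof.
  intros hI hc.
  destruct (open_interval_inhabited I hI) as [a ha].
  exists (fun t => RInt f a t); intros l hl.
  apply (is_derive_RInt f (fun t => RInt f a t) a l); [|now apply hc].
  apply filter_imp with I; [|now apply open_interval_locally].
  intros b hb; apply (RInt_correct (V := R_CompleteNormedModule)), ex_RInt_continuous.
  intros t ht; apply hc.
  destruct (Rle_dec a b) as [h|h].
  - rewrite Rmin_left, Rmax_right in ht by lra.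
    now apply (open_interval_between I a b).
  - rewrite Rmin_right, Rmax_left in ht by lra.
    now apply (open_interval_between I b a).
Qed.

(** * Angles on the circle and orthonormal frames *)

(** The sine of [acos a] is [Rabs b], so the sign of [b] decides between [acos a] and its
    opposite. *)
Lemma circle_angle (a b : R) :
  a ^ 2 + b ^ 2 = 1 -> exists t, a = cos t /\ b = sin t.
Proof.
  intros h.
  assert (ha : -1 <= a <= 1) by nra.
  assert (hs : sqrt (1 - a²) = Rabs b).
  { rewrite <- sqrt_Rsqr_abs; f_equal; unfold Rsqr; lra. }
  destruct (Rle_dec 0 b) as [hb|hb].
  - exists (acos a); rewrite cos_acos, sin_acos, hs, Rabs_right; lra.
  - exists (- acos a).
    rewrite cos_neg, sin_neg, cos_acos, sin_acos, hs, Rabs_left; lra.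
Qed.

(** The integrand [a b' - b a'] is the angular speed of [(a, b)]. Once [phi] has this speed and the
    right initial value, the inner product of [(a, b)] with [(cos phi, sin phi)] is constantly 1, so
    these two unit vectors coincide. *)
Lemma circle_lift (I : R -> Prop) (a b a' b' Phi : R -> R) :
  open_interval I ->
  (forall l, I l -> is_derive a l (a' l)) ->
  (forall l, I l -> is_derive b l (b' l)) ->
  (forall l, I l -> a l ^ 2 + b l ^ 2 = 1) ->
  (forall l, I l -> is_derive Phi l (a l * b' l - b l * a' l)) ->
  exists phi0, forall l, I l ->
    a l = cos (phi0 + Phi l) /\ b l = sin (phi0 + Phi l).
Proof.
  intros hI ha hb hab hPhi.
  destruct (open_interval_inhabited I hI) as [l0 hl0].
  destruct (circle_angle _ _ (hab l0 hl0)) as [t0 [hc0 hs0]].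
  (* This shift makes the angle equal to [t0] at the base point [l0]. *)
  exists (t0 - Phi l0).
  set (phi := fun l => t0 - Phi l0 + Phi l).
  assert (tangent : forall l, I l -> a l * a' l + b l * b' l = 0).
  { intros l hl.
    enough (2 * (a l * a' l + b l * b' l) = 0) by lra.
    apply (is_derive_eq_on I (fun t => a t ^ 2 + b t ^ 2) (fun _ => 1) l); auto.
    - auto_derive; [repeat split; [exists (a' l)|exists (b' l)]; auto|].
      replace (Derive (fun x => a x) l) with (a' l)
        by (symmetry; now apply is_derive_unique, ha).
      replace (Derive (fun x => b x) l) with (b' l)
        by (symmetry; now apply is_derive_unique, hb).
      ring.
    - apply (is_derive_const (K := R_AbsRing) (V := R_NormedModule)). }
  (* The velocity is orthogonal to the position, hence is the angular speed times the position
     turned by a right angle. *)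
  assert (rate : forall l, I l -> a' l = - b l * (a l * b' l - b l * a' l) /\
                                  b' l = a l * (a l * b' l - b l * a' l)).
  { intros l hl; specialize (tangent l hl); specialize (hab l hl).
    split.
    - transitivity (a' l * (a l ^ 2 + b l ^ 2) - a l * (a l * a' l + b l * b' l));
        [rewrite hab, tangent; ring | ring].
    - transitivity (b' l * (a l ^ 2 + b l ^ 2) - b l * (a l * a' l + b l * b' l));
        [rewrite hab, tangent; ring | ring]. }
  assert (hphi : forall l, I l -> is_derive phi l (a l * b' l - b l * a' l)).
  { intros l hl; unfold phi.
    auto_derive; [eexists; now apply hPhi|].
    replace (Derive (fun x => Phi x) l) with (a l * b' l - b l * a' l)
      by (symmetry; now apply is_derive_unique, hPhi).
    ring. }
  assert (hphi0 : phi l0 = t0) by (unfold phi; ring).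
  assert (hA : forall l, I l -> a l * cos (phi l) + b l * sin (phi l) = 1).
  { intros l hl.
    transitivity (a l0 * cos (phi l0) + b l0 * sin (phi l0)).
    - apply (derive_zero_const I (fun l => a l * cos (phi l) + b l * sin (phi l)));
        auto.
      intros t ht.
      destruct (rate t ht) as [r1 r2].
      auto_derive; [repeat split; eexists; auto|].
      replace (Derive (fun x => a x) t) with (a' t)
        by (symmetry; now apply is_derive_unique, ha).
      replace (Derive (fun x => b x) t) with (b' t)
        by (symmetry; now apply is_derive_unique, hb).
      replace (Derive (fun x => phi x) t) with (a t * b' t - b t * a' t)
        by (symmetry; now apply is_derive_unique, hphi).
      set (d := a t * b' t - b t * a' t) in *; rewrite r1, r2; ring.
    - rewrite hphi0, hc0, hs0.
      generalize (sin2_cos2 t0); unfold Rsqr; lra. }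
  (* Lagrange's identity: the squares of the inner product and of the cross product of two unit
     vectors add up to 1. *)
  assert (hB : forall l, I l -> b l * cos (phi l) - a l * sin (phi l) = 0).
  { intros l hl; specialize (hA l hl); specialize (hab l hl).
    generalize (sin2_cos2 (phi l)); unfold Rsqr; intros hsc.
    apply Rsqr_0_uniq; unfold Rsqr.
    replace ((b l * cos (phi l) - a l * sin (phi l)) *
             (b l * cos (phi l) - a l * sin (phi l)))
      with ((a l ^ 2 + b l ^ 2) *
              (sin (phi l) * sin (phi l) + cos (phi l) * cos (phi l)) -
            (a l * cos (phi l) + b l * sin (phi l)) ^ 2) by ring.
    rewrite hA, hab, hsc; ring. }
  intros l hl; fold (phi l).
  specialize (hA l hl); specialize (hB l hl).
  generalize (sin2_cos2 (phi l)); unfold Rsqr; intros hsc.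
  (* Rotating the pair (inner product, cross product) by [phi l] gives back [(a, b)]. *)
  split.
  - transitivity (cos (phi l) * (a l * cos (phi l) + b l * sin (phi l)) -
                  sin (phi l) * (b l * cos (phi l) - a l * sin (phi l)));
      [|rewrite hA, hB; ring].
    transitivity (a l * (sin (phi l) * sin (phi l) + cos (phi l) * cos (phi l)));
      [rewrite hsc; ring | ring].
  - transitivity (sin (phi l) * (a l * cos (phi l) + b l * sin (phi l)) +
                  cos (phi l) * (b l * cos (phi l) - a l * sin (phi l)));
      [|rewrite hA, hB; ring].
    transitivity (b l * (sin (phi l) * sin (phi l) + cos (phi l) * cos (phi l)));
      [rewrite hsc; ring | ring].
Qed.

(* Cramer's rule: [s q] is the combination of the cross products of the rows
   with coefficients the components of [q], and for an orthonormal frame those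
   cross products are [s] times the rows. *)
Lemma orthonormal_frame_third (p1 p2 p3 t1 t2 t3 n1 n2 n3 s : R) :
  p1 * p1 + p2 * p2 + p3 * p3 = 1 ->
  t1 * t1 + t2 * t2 + t3 * t3 = 1 ->
  n1 * n1 + n2 * n2 + n3 * n3 = 1 ->
  p1 * t1 + p2 * t2 + p3 * t3 = 0 ->
  n1 * p1 + n2 * p2 + n3 * p3 = 0 ->
  n1 * t1 + n2 * t2 + n3 * t3 = 0 ->
  s = n1 * (p2 * t3 - p3 * t2) + n2 * (p3 * t1 - p1 * t3) +
      n3 * (p1 * t2 - p2 * t1) ->
  s * s = 1 /\
  p1 * t2 - p2 * t1 = s * n3 /\
  p3 ^ 2 + t3 ^ 2 + n3 ^ 2 = 1 /\
  forall q1 q2 q3, q3 = (q1 * p1 + q2 * p2 + q3 * p3) * p3 +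
                        (q1 * t1 + q2 * t2 + q3 * t3) * t3 +
                        (q1 * n1 + q2 * n2 + q3 * n3) * n3.
Proof.
  intros pp tt nn pt np nt hs.
  assert (ss : s * s = 1).
  (* The square of a determinant is the Gram determinant of its rows, written out here; for an
     orthonormal frame the Gram matrix is the identity. *)
  { transitivity ((p1 * p1 + p2 * p2 + p3 * p3) * (t1 * t1 + t2 * t2 + t3 * t3) *
                  (n1 * n1 + n2 * n2 + n3 * n3)
      + 2 * (p1 * t1 + p2 * t2 + p3 * t3) * (n1 * t1 + n2 * t2 + n3 * t3) *
          (n1 * p1 + n2 * p2 + n3 * p3)
      - (p1 * p1 + p2 * p2 + p3 * p3) * (n1 * t1 + n2 * t2 + n3 * t3) ^ 2
      - (t1 * t1 + t2 * t2 + t3 * t3) * (n1 * p1 + n2 * p2 + n3 * p3) ^ 2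
      - (n1 * n1 + n2 * n2 + n3 * n3) * (p1 * t1 + p2 * t2 + p3 * t3) ^ 2).
    - rewrite hs; ring.
    - rewrite pp, tt, nn, pt, np, nt; ring. }
  assert (cramer : forall q1 q2 q3,
            s * q3 = (q1 * p1 + q2 * p2 + q3 * p3) * (t1 * n2 - t2 * n1) +
                     (q1 * t1 + q2 * t2 + q3 * t3) * (n1 * p2 - n2 * p1) +
                     (q1 * n1 + q2 * n2 + q3 * n3) * (p1 * t2 - p2 * t1))
    by (intros; rewrite hs; ring).
  assert (hn : p1 * t2 - p2 * t1 = s * n3)
    by (rewrite (cramer n1 n2 n3), np, nt, nn; ring).
  assert (ht : n1 * p2 - n2 * p1 = s * t3).
  { rewrite (cramer t1 t2 t3), tt.
    replace (t1 * p1 + t2 * p2 + t3 * p3) with 0 by lra.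
    replace (t1 * n1 + t2 * n2 + t3 * n3) with 0 by lra; ring. }
  assert (hp : t1 * n2 - t2 * n1 = s * p3).
  { rewrite (cramer p1 p2 p3), pp, pt.
    replace (p1 * n1 + p2 * n2 + p3 * n3) with 0 by lra; ring. }
  assert (expand : forall q1 q2 q3, q3 = (q1 * p1 + q2 * p2 + q3 * p3) * p3 +
                        (q1 * t1 + q2 * t2 + q3 * t3) * t3 +
                        (q1 * n1 + q2 * n2 + q3 * n3) * n3).
  { intros q1 q2 q3; apply Rmult_eq_reg_l with s; [|nra].
    rewrite (cramer q1 q2 q3), hn, ht, hp; ring. }
  repeat split; auto.
  (* The expansion of the third basis vector gives the sum of the squared last components. *)
  generalize (expand 0 0 1); lra.
Qed.

(** * Geometry of the surface along its profile curve *)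

Lemma Derive_cosh (v : R) : Derive cosh v = sinh v.
Proof. apply is_derive_unique, is_derive_Reals, derivable_pt_lim_cosh. Qed.

Lemma Derive_sinh (v : R) : Derive sinh v = cosh v.
Proof. apply is_derive_unique, is_derive_Reals, derivable_pt_lim_sinh. Qed.

Lemma r_u_rot2 (x y w : R -> R) (u v : R) :
  r_u (rot2 x y w) u v = rot2 (Derive x) (Derive y) (Derive w) u v.
Proof.
  unfold r_u, vDerive, rot2; simpl.
  now rewrite !Derive_scal_l.
Qed.

Lemma vDerive_ext (f g : R -> E41) (t : R) :
  (forall s, f s = g s) -> vDerive f t = vDerive g t.
Proof.
  intros h; unfold vDerive; f_equal; apply Derive_ext; intros s; now rewrite h.
Qed.

Lemma r_uu_rot2 (x y w : R -> R) (u v : R) :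
  r_uu (rot2 x y w) u v =
  rot2 (Derive (Derive x)) (Derive (Derive y)) (Derive (Derive w)) u v.
Proof.
  unfold r_uu; rewrite <- r_u_rot2.
  apply vDerive_ext; intros s; apply r_u_rot2.
Qed.

Lemma r_v_rot2 (x y w : R -> R) (u v : R) :
  r_v (rot2 x y w) u v = Vec 0 0 (w u * sinh v) (w u * cosh v).
Proof.
  unfold r_v, vDerive, rot2; simpl.
  now rewrite !Derive_const, !Derive_scal, Derive_cosh, Derive_sinh.
Qed.

Lemma r_vv_rot2 (x y w : R -> R) (u v : R) :
  r_vv (rot2 x y w) u v = Vec 0 0 (w u * cosh v) (w u * sinh v).
Proof.
  transitivity (vDerive (fun s => Vec 0 0 (w u * sinh s) (w u * cosh s)) v).
  - apply vDerive_ext; intros s; apply r_v_rot2.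
  - unfold vDerive; simpl.
    now rewrite !Derive_const, !Derive_scal, Derive_cosh, Derive_sinh.
Qed.

(** At [v = 0] the vector [r_v] points along the time axis, so [N] has no fourth component there and
    becomes a Euclidean unit vector orthogonal to the profile and to its velocity. *)
Lemma normal_rot2_at_0 (J : R -> Prop) (x y w : R -> R) (N : R -> R -> E41)
  (u : R) :
  unit_normal_field (rot2 x y w) J N -> J u -> 0 < w u ->
  c1 (N u 0) * x u + c2 (N u 0) * y u + c3 (N u 0) * w u = 0 /\
  c1 (N u 0) * Derive x u + c2 (N u 0) * Derive y u +
    c3 (N u 0) * Derive w u = 0 /\
  c1 (N u 0) * c1 (N u 0) + c2 (N u 0) * c2 (N u 0) +
    c3 (N u 0) * c3 (N u 0) = 1 /\
  c3 (N u 0) = lambda (rot2 x y w) N u 0 * w u /\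
  kappa (rot2 x y w) N u 0 =
    Derive (Derive x) u * c1 (N u 0) + Derive (Derive y) u * c2 (N u 0) +
    Derive (Derive w) u * c3 (N u 0).
Proof.
  intros hN hu hw.
  generalize (normal_r _ _ _ hN u 0 hu) (normal_u _ _ _ hN u 0 hu)
    (normal_v _ _ _ hN u 0 hu) (normal_unit _ _ _ hN u 0 hu).
  unfold lambda, kappa.
  rewrite r_u_rot2, r_uu_rot2, r_v_rot2, r_vv_rot2.
  unfold rot2, minkowski; simpl; rewrite cosh_0, sinh_0.
  intros hr hd hv h1.
  assert (h4 : c4 (N u 0) = 0) by nra.
  rewrite h4 in *.
  repeat split; try lra.
  (* The square of the timelike vector [r_v] is [- w^2], so [lambda] is the third component of [N]
     divided by [w]. *)
  rewrite Rabs_left by nra.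
  field; lra.
Qed.

Lemma smooth_is_derive (J : R -> Prop) (f : R -> R) (t : R) :
  smooth_on J f -> J t -> is_derive f t (Derive f t).
Proof. intros h ht; apply Derive_correct, (h 1%nat t ht). Qed.

Lemma smooth_is_derive_2 (J : R -> Prop) (f : R -> R) (t : R) :
  smooth_on J f -> J t -> is_derive (Derive f) t (Derive (Derive f) t).
Proof. intros h ht; apply Derive_correct, (h 2%nat t ht). Qed.

Lemma ex_derive_eta (f : R -> R) (t d : R) :
  is_derive f t d -> ex_derive (fun s => f s) t.
Proof. now exists d. Qed.

(** With [p = (x, y, w)], differentiating [p.p = 1], [p'.p' = 1] and then [p.p' = 0] gives in turn
    [p.p' = 0], [p''.p' = 0] and [p''.p = - p'.p' = -1]. *)
Lemma profile_products (J : R -> Prop) (x y w : R -> R) (u : R) :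
  hyperbolic_rotational_2 J x y w -> J u ->
  x u * Derive x u + y u * Derive y u + w u * Derive w u = 0 /\
  Derive (Derive x) u * Derive x u + Derive (Derive y) u * Derive y u +
    Derive (Derive w) u * Derive w u = 0 /\
  Derive (Derive x) u * x u + Derive (Derive y) u * y u +
    Derive (Derive w) u * w u = -1.
Proof.
  intros hM hu.
  pose proof (rot2_J _ _ _ _ hM) as hJ.
  assert (dx : forall t, J t -> is_derive x t (Derive x t))
    by (intros; eapply smooth_is_derive; eauto; apply hM).
  assert (dy : forall t, J t -> is_derive y t (Derive y t))
    by (intros; eapply smooth_is_derive; eauto; apply hM).
  assert (dw : forall t, J t -> is_derive w t (Derive w t))
    by (intros; eapply smooth_is_derive; eauto; apply hM).
  assert (ddx : is_derive (Derive x) u (Derive (Derive x) u))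
    by (eapply smooth_is_derive_2; eauto; apply hM).
  assert (ddy : is_derive (Derive y) u (Derive (Derive y) u))
    by (eapply smooth_is_derive_2; eauto; apply hM).
  assert (ddw : is_derive (Derive w) u (Derive (Derive w) u))
    by (eapply smooth_is_derive_2; eauto; apply hM).
  (* Stated on all of [J], since this relation is itself differentiated in the last case. *)
  assert (orth : forall t, J t ->
            x t * Derive x t + y t * Derive y t + w t * Derive w t = 0).
  { intros t ht.
    enough (2 * (x t * Derive x t + y t * Derive y t + w t * Derive w t) = 0)
      by lra.
    apply (is_derive_eq_on J (fun s => x s ^ 2 + y s ^ 2 + w s ^ 2)
             (fun _ => 1) t); auto.
    - apply hM.
    - auto_derive; [repeat split; eapply ex_derive_eta; auto|].
      change (Derive (fun s => x s)) with (Derive x).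
      change (Derive (fun s => y s)) with (Derive y).
      change (Derive (fun s => w s)) with (Derive w); ring.
    - apply (is_derive_const (K := R_AbsRing) (V := R_NormedModule)). }
  split; [now apply orth|split].
  - enough (2 * (Derive (Derive x) u * Derive x u +
                 Derive (Derive y) u * Derive y u +
                 Derive (Derive w) u * Derive w u) = 0) by lra.
    apply (is_derive_eq_on J
             (fun s => Derive x s ^ 2 + Derive y s ^ 2 + Derive w s ^ 2)
             (fun _ => 1) u); auto.
    + apply hM.
    + auto_derive; [repeat split; eapply ex_derive_eta; eauto|].
      change (Derive (fun s => Derive x s)) with (Derive (Derive x)).
      change (Derive (fun s => Derive y s)) with (Derive (Derive y)).
      change (Derive (fun s => Derive w s)) with (Derive (Derive w)).
      change (Derive (fun s => x s)) with (Derive x).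
      change (Derive (fun s => y s)) with (Derive y).
      change (Derive (fun s => w s)) with (Derive w); ring.
    + apply (is_derive_const (K := R_AbsRing) (V := R_NormedModule)).
  - enough (Derive (Derive x) u * x u + Derive (Derive y) u * y u +
              Derive (Derive w) u * w u +
            (Derive x u ^ 2 + Derive y u ^ 2 + Derive w u ^ 2) = 0)
      by (rewrite (rot2_arclength _ _ _ _ hM u hu) in *; lra).
    apply (is_derive_eq_on J
             (fun s => x s * Derive x s + y s * Derive y s + w s * Derive w s)
             (fun _ => 0) u); auto.
    + auto_derive; [repeat split; eapply ex_derive_eta; eauto|].
      change (Derive (fun s => Derive x s)) with (Derive (Derive x)).
      change (Derive (fun s => Derive y s)) with (Derive (Derive y)).
      change (Derive (fun s => Derive w s)) with (Derive (Derive w)).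
      change (Derive (fun s => x s)) with (Derive x).
      change (Derive (fun s => y s)) with (Derive y).
      change (Derive (fun s => w s)) with (Derive w); ring.
    + apply (is_derive_const (K := R_AbsRing) (V := R_NormedModule)).
Qed.

(** The triple product of the normal, the profile and its velocity, that is, the orientation of the
    frame at [v = 0]. *)
Definition profile_det (x y w : R -> R) (N : R -> R -> E41) (u : R) : R :=
  c1 (N u 0) * (y u * Derive w u - w u * Derive y u) +
  c2 (N u 0) * (w u * Derive x u - x u * Derive w u) +
  c3 (N u 0) * (x u * Derive y u - y u * Derive x u).

Lemma profile_equations (J : R -> Prop) (x y w : R -> R) (N : R -> R -> E41)
  (u : R) :
  hyperbolic_rotational_2 J x y w -> unit_normal_field (rot2 x y w) J N ->
  J u ->
  let k1 := kappa (rot2 x y w) N u 0 in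
  let k2 := lambda (rot2 x y w) N u 0 in
  let s := profile_det x y w N u in
  s * s = 1 /\
  x u * Derive y u - y u * Derive x u = s * (k2 * w u) /\
  w u ^ 2 + Derive w u ^ 2 + (k2 * w u) ^ 2 = 1 /\
  Derive (Derive w) u = - w u + k1 * (k2 * w u).
Proof.
  intros hM hN hu k1 k2 s.
  destruct (profile_products J x y w u hM hu) as [pt [tt' pq]].
  destruct (normal_rot2_at_0 J x y w N u hN hu (rot2_w_pos _ _ _ _ hM u hu))
    as [np [nt [nn [n3 hk]]]].
  fold k2 in n3; fold k1 in hk.
  destruct (orthonormal_frame_third (x u) (y u) (w u)
    (Derive x u) (Derive y u) (Derive w u)
    (c1 (N u 0)) (c2 (N u 0)) (c3 (N u 0)) s) as [hs [hd [hsq he]]]; auto.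
  - generalize (rot2_sphere _ _ _ _ hM u hu); lra.
  - generalize (rot2_arclength _ _ _ _ hM u hu); lra.
  - rewrite <- n3; repeat split; auto.
    (* The coordinates of [p''] in the frame are [-1], [0] and [k1]; the last components of the
       frame are [w], [w'] and [k2 w]. *)
    rewrite (he (Derive (Derive x) u) (Derive (Derive y) u)
               (Derive (Derive w) u)), pq, tt', <- hk.
    ring.
Qed.

Lemma profile_det_continuous (J : R -> Prop) (x y w : R -> R)
  (N : R -> R -> E41) (u : R) :
  hyperbolic_rotational_2 J x y w -> unit_normal_field (rot2 x y w) J N ->
  J u -> continuous (profile_det x y w N) u.
Proof.
  intros hM hN hu.
  assert (c0 : forall f, smooth_on J f -> continuous f u).
  { intros f hf; apply (ex_derive_continuous f); exists (Derive f u).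
    now apply (smooth_is_derive J). }
  assert (c1' : forall f, smooth_on J f -> continuous (Derive f) u).
  { intros f hf; apply (ex_derive_continuous (Derive f)).
    exists (Derive (Derive f) u); now apply (smooth_is_derive_2 J). }
  (* Joint continuity of [N] is restricted to the line [v = 0]. *)
  assert (cN : forall p : E41 -> R,
            continuous (fun q : R * R => p (N (fst q) (snd q))) (u, 0) ->
            continuous (fun t => p (N t 0)) u).
  { intros p hp.
    apply (continuous_comp_2 (fun t : R => t) (fun _ : R => 0)
             (fun a b => p (N a b))); [apply continuous_id|apply continuous_const|].
    exact hp. }
  destruct (normal_cont _ _ _ hN u 0 hu) as [n1 [n2 [n3 _]]].
  apply cN in n1; apply cN in n2; apply cN in n3.
  assert (minor : forall f g, smooth_on J f -> smooth_on J g ->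
            continuous (fun t => f t * Derive g t - g t * Derive f t) u).
  { intros f g hf hg.
    apply (continuous_minus (fun t => f t * Derive g t)
                            (fun t => g t * Derive f t));
      apply (continuous_mult (K := R_AbsRing)); auto. }
  destruct hM.
  unfold profile_det.
  apply (continuous_plus (V := R_NormedModule));
    [apply (continuous_plus (V := R_NormedModule))|];
    apply (continuous_mult (K := R_AbsRing)); auto.
Qed.

(** * Change of parameter and the Codazzi equation *)

(** The chain rule for [lam (U l) = l]. In particular [lam'] has no zero, as the Codazzi equation
    requires. *)
Lemma parameter_derivative (J I : R -> Prop) (lam U : R -> R) (l : R) :
  change_of_parameter J I lam U -> I l ->
  Derive U l * Derive lam (U l) = 1.
Proof.
  intros hpar hl.
  destruct hpar as [hI hlam hU _ hfrom].
  apply (is_derive_eq_on I (fun t => lam (U t)) (fun t => t) l); auto.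
  - intros t ht; now apply hfrom.
  - apply (is_derive_comp lam U l).
    + apply (smooth_is_derive J); [assumption | now apply hfrom].
    + now apply (smooth_is_derive I).
  - apply (is_derive_id (K := R_AbsRing)).
Qed.

(* Differentiating the first equation only gives the Codazzi equation
   multiplied by [lam]; differentiating once more recovers it at a zero of
   [lam], where [lam' <> 0]. *)
Lemma codazzi_equation (J : R -> Prop) (w lam : R -> R) (H u : R) :
  open_interval J -> smooth_on J w -> smooth_on J lam ->
  (forall t, J t -> 0 < w t) ->
  (forall t, J t -> w t ^ 2 + Derive w t ^ 2 + (lam t * w t) ^ 2 = 1) ->
  (forall t, J t ->
     Derive (Derive w) t = - w t + (lam t + 2 * H) * (lam t * w t)) ->
  J u -> Derive lam u <> 0 ->
  Derive lam u * w u + 2 * (lam u + H) * Derive w u = 0.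
Proof.
  intros hJ hw hlam wpos h1 h2 hu hlam0.
  set (g := fun t => Derive lam t * w t + 2 * (lam t + H) * Derive w t).
  assert (dw : forall t, J t -> is_derive w t (Derive w t))
    by (intros; eapply smooth_is_derive; eauto).
  assert (dl : forall t, J t -> is_derive lam t (Derive lam t))
    by (intros; eapply smooth_is_derive; eauto).
  assert (ddw : forall t, J t -> is_derive (Derive w) t (Derive (Derive w) t))
    by (intros; eapply smooth_is_derive_2; eauto).
  assert (ddl : forall t, J t -> is_derive (Derive lam) t (Derive (Derive lam) t))
    by (intros; eapply smooth_is_derive_2; eauto).
  assert (hg : forall t, J t -> lam t * g t = 0).
  { intros t ht.
    (* After substituting [w''] the terms [2 w w'] cancel and the derivative of the first equation
       factors as shown; [w] is positive. *)
    enough (2 * w t * (lam t * g t) = 0) by (specialize (wpos t ht); nra).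
    apply (is_derive_eq_on J
             (fun s => w s ^ 2 + Derive w s ^ 2 + (lam s * w s) ^ 2)
             (fun _ => 1) t); auto.
    - auto_derive; [repeat split; eapply ex_derive_eta; eauto|].
      change (Derive (fun s => Derive w s)) with (Derive (Derive w)).
      change (Derive (fun s => w s)) with (Derive w).
      change (Derive (fun s => lam s)) with (Derive lam).
      rewrite (h2 t ht); unfold g; ring.
    - apply (is_derive_const (K := R_AbsRing) (V := R_NormedModule)). }
  fold (g u).
  destruct (Req_dec (lam u) 0) as [h0|h0].
  - assert (dg : is_derive g u (Derive g u)).
    { apply Derive_correct; unfold g; auto_derive.
      repeat split; eapply ex_derive_eta; eauto. }
    assert (hd : Derive lam u * g u + lam u * Derive g u = 0).
    { apply (is_derive_eq_on J (fun s => lam s * g s) (fun _ => 0) u); auto.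
      - auto_derive; [repeat split; eapply ex_derive_eta; eauto|].
        change (Derive (fun s => g s)) with (Derive g).
        change (Derive (fun s => lam s)) with (Derive lam); ring.
      - apply (is_derive_const (K := R_AbsRing) (V := R_NormedModule)). }
    rewrite h0 in hd; apply Rmult_eq_reg_l with (Derive lam u); lra.
  - apply Rmult_eq_reg_l with (lam u); [|exact h0].
    rewrite (hg u hu); ring.
Qed.

(** * Range of [lambda] and derivative of the angle *)

(** Completing the square: [c^2] times the assumed positive quantity is
    [1 + 2 H c^2 - c^4 - (c^2 l - 1)^2]. Hence the discriminant is positive, which is the bound on
    [H], and [c^2 l] lies within its square root of 1. *)
Lemma lambda_range (H c l : R) :
  0 < c -> 2 * (H + l) - (l ^ 2 + 1) * c ^ 2 > 0 ->
  H > 1 / 2 * (c ^ 2 - 1 / c ^ 2) /\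
  (1 - sqrt (1 + 2 * H * c ^ 2 - c ^ 4)) / c ^ 2 < l /\
  l < (1 + sqrt (1 + 2 * H * c ^ 2 - c ^ 4)) / c ^ 2.
Proof.
  intros hc h.
  assert (hc2 : 0 < c ^ 2) by nra.
  assert (hd : (c ^ 2 * l - 1) ^ 2 < 1 + 2 * H * c ^ 2 - c ^ 4).
  { enough (0 < c ^ 2 * (2 * (H + l) - (l ^ 2 + 1) * c ^ 2)) by nra.
    apply Rmult_lt_0_compat; lra. }
  assert (hr : Rabs (c ^ 2 * l - 1) < sqrt (1 + 2 * H * c ^ 2 - c ^ 4)).
  { rewrite <- sqrt_Rsqr_abs; apply sqrt_lt_1_alt; rewrite Rsqr_pow2.
    split; [apply pow2_ge_0 | exact hd]. }
  apply Rabs_def2 in hr.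
  repeat split.
  - apply Rmult_lt_reg_l with (2 * c ^ 2); [lra|].
    replace (2 * c ^ 2 * (1 / 2 * (c ^ 2 - 1 / c ^ 2))) with (c ^ 4 - 1)
      by (field; lra).
    generalize (pow2_ge_0 (c ^ 2 * l - 1)); lra.
  - apply Rmult_lt_reg_r with (c ^ 2); [lra|].
    unfold Rdiv; rewrite Rmult_assoc, Rinv_l by lra; lra.
  - apply Rmult_lt_reg_r with (c ^ 2); [lra|].
    unfold Rdiv; rewrite Rmult_assoc, Rinv_l by lra; lra.
Qed.

Lemma phi_integrand_continuous (H c l : R) :
  H + l > 0 -> 2 * (H + l) - c ^ 2 <> 0 ->
  2 * (H + l) - (l ^ 2 + 1) * c ^ 2 > 0 ->
  continuous (phi_integrand H c) l.
Proof.
  intros h1 h2 h3.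
  apply (ex_derive_continuous (phi_integrand H c)).
  unfold phi_integrand; auto_derive.
  repeat split; [lra|lra|].
  repeat apply Rmult_integral_contrapositive_currified; try exact h2;
    apply Rgt_not_eq, sqrt_lt_R0; [exact h1 | exact h3].
Qed.

(* [w1] and [U1] are the values of [dw/du] and [du/dlambda], and [s] the sign
   of the frame; [e] is the sign of [s w1]. *)
Lemma angular_speed (H c l w w1 s e U1 : R) :
  0 < c -> H + l > 0 -> 2 * (H + l) - c ^ 2 <> 0 ->
  2 * (H + l) - (l ^ 2 + 1) * c ^ 2 > 0 ->
  w = c / sqrt (2 * (H + l)) ->
  w ^ 2 + w1 ^ 2 + (l * w) ^ 2 = 1 ->
  s * s = 1 -> e * e = 1 -> 0 < e * (s * w1) ->
  w + 2 * (l + H) * w1 * U1 = 0 ->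
  s * (l * w) * U1 / (1 - w ^ 2) = - e * (c ^ 2 / sqrt 2) * phi_integrand H c l.
Proof.
  intros hc hA hB hQ hw h1 hs he hpos hU; unfold phi_integrand.
  rewrite sqrt_mult in hw by lra.
  set (q := sqrt (2 * (H + l) - (l ^ 2 + 1) * c ^ 2)) in *.
  assert (q0 : 0 < q) by (apply sqrt_lt_R0; lra).
  assert (q2 : q ^ 2 = 2 * (H + l) - (l ^ 2 + 1) * c ^ 2)
    by (apply pow2_sqrt; lra).
  set (A := sqrt (H + l)) in *.
  assert (A0 : 0 < A) by (apply sqrt_lt_R0; lra).
  assert (A2 : A ^ 2 = H + l) by (apply pow2_sqrt; lra).
  set (t := sqrt 2) in *.
  assert (t0 : 0 < t) by (apply sqrt_lt_R0; lra).
  assert (t2 : t ^ 2 = 2) by (apply pow2_sqrt; lra).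
  assert (hw2 : w ^ 2 = c ^ 2 / (2 * A ^ 2)).
  { rewrite hw, <- t2; field; lra. }
  (* The frame relation gives [w1^2 = 1 - (1 + l^2) w^2 = q^2 / (2 A^2)]; the factor [e s] selects
     the positive root. *)
  assert (hw1 : e * (s * w1) = q / (t * A)).
  { assert (0 < q / (t * A))
      by (apply Rdiv_lt_0_compat; [lra | now apply Rmult_lt_0_compat]).
    apply Rsqr_inj; [lra|lra|]; unfold Rsqr.
    replace (q / (t * A) * (q / (t * A))) with (q ^ 2 / (t ^ 2 * A ^ 2))
      by (field; lra).
    replace (e * (s * w1) * (e * (s * w1))) with ((e * e) * (s * s) * w1 ^ 2)
      by ring.
    rewrite he, hs, q2, t2.
    replace (w1 ^ 2) with (1 - (1 + l ^ 2) * w ^ 2) by lra.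
    rewrite hw2, <- A2; field; lra. }
  (* Inserting this root in the Codazzi relation [2 A^2 w1 U1 = - w] eliminates [w1]; the sign [- e]
     of the result comes from there. *)
  assert (hsU : s * U1 * (2 * A ^ 2) * q = - e * w * (t * A)).
  { assert (hk : e * (s * w1) * (t * A) = q) by (rewrite hw1; field; lra).
    rewrite <- hk.
    replace (s * U1 * (2 * A ^ 2) * (e * (s * w1) * (t * A)))
      with ((s * s) * e * (t * A) * (2 * A ^ 2 * w1 * U1)) by ring.
    rewrite hs, A2.
    replace (2 * (H + l) * w1 * U1) with (- w) by lra; ring. }
  assert (hB' : 2 * A ^ 2 - c ^ 2 <> 0) by (rewrite A2; exact hB).
  assert (hsU' : s * U1 = - e * w * t / (2 * A * q)).
  { apply Rmult_eq_reg_r with (2 * A ^ 2 * q);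
      [|apply Rgt_not_eq; nra].
    transitivity (- e * w * (t * A)); [rewrite <- hsU; ring | field; lra]. }
  replace (s * (l * w) * U1 / (1 - w ^ 2)) with (s * U1 * l * w / (1 - w ^ 2))
    by (unfold Rdiv; ring).
  rewrite hsU'.
  replace (- e * w * t / (2 * A * q) * l * w / (1 - w ^ 2))
    with (- e * w ^ 2 * t / (2 * A * q) * l / (1 - w ^ 2))
    by (unfold Rdiv; ring).
  (* Now [1 - w^2] is [(2 A^2 - c^2) / (2 A^2)], the source of the factor [2 (H + l) - c^2] in the
     integrand. *)
  rewrite hw2, <- A2.
  replace (c ^ 2 / t) with (c ^ 2 * t / 2) by (rewrite <- t2; field; lra).
  field; repeat split; try lra.
Qed.

(** * Integration of the profile curve in the parameter [lambda] *)

Theorem corollary3p4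
  (J I : R -> Prop) (x y w : R -> R) (N : R -> R -> E41)
  (lam U : R -> R) (H : R)
  (hM : hyperbolic_rotational_2 J x y w)
  (hN : unit_normal_field (rot2 x y w) J N)
  (hlam : forall u v : R, J u -> lambda (rot2 x y w) N u v = lam u)
  (hpar : change_of_parameter J I lam U)
  (hW : forall u v : R, J u ->
          kappa (rot2 x y w) N u v = lambda (rot2 x y w) N u v + 2 * H)
  (hH : forall u v : R, J u -> mean_curvature (rot2 x y w) N u v = H)
  (hpos : forall l : R, I l -> H + l > 0) :
  exists c : R, 0 < c /\
    (forall l : R, I l -> w (U l) = c / sqrt (2 * (H + l))) /\
    ((forall l : R, I l ->
        2 * (H + l) - c ^ 2 <> 0 /\
        2 * (H + l) - (l ^ 2 + 1) * c ^ 2 > 0) ->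
     H > 1 / 2 * (c ^ 2 - 1 / c ^ 2) /\
     (forall l : R, I l ->
        (1 - sqrt (1 + 2 * H * c ^ 2 - c ^ 4)) / c ^ 2 < l /\
        l < (1 + sqrt (1 + 2 * H * c ^ 2 - c ^ 4)) / c ^ 2) /\
     exists (phi0 eps : R) (F phi : R -> R),
       (eps = 1 \/ eps = -1) /\
       antiderivative_on I (phi_integrand H c) F /\
       (forall l : R, I l -> phi l = phi0 + eps * (c ^ 2 / sqrt 2 * F l)) /\
       (forall l : R, I l ->
          x (U l) = sqrt (1 - w (U l) ^ 2) * cos (phi l) /\
          y (U l) = sqrt (1 - w (U l) ^ 2) * sin (phi l))).
Proof.
  pose proof (param_I _ _ _ _ hpar) as hI.
  pose proof (param_smooth _ _ _ _ hpar) as slam.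
  pose proof (param_smooth_inv _ _ _ _ hpar) as sU.
  pose proof (rot2_J _ _ _ _ hM) as hJ.
  pose proof (rot2_w_pos _ _ _ _ hM) as wpos.
  pose proof (rot2_smooth_w _ _ _ _ hM) as sw.
  assert (hUJ : forall l, I l -> J (U l))
    by (intros l hl; now apply (param_from _ _ _ _ hpar)).
  assert (hlU : forall l, I l -> lam (U l) = l)
    by (intros l hl; now apply (param_from _ _ _ _ hpar)).
  set (s := profile_det x y w N).
  assert (heq : forall u, J u ->
    s u * s u = 1 /\
    x u * Derive y u - y u * Derive x u = s u * (lam u * w u) /\
    w u ^ 2 + Derive w u ^ 2 + (lam u * w u) ^ 2 = 1 /\
    Derive (Derive w) u = - w u + (lam u + 2 * H) * (lam u * w u)).
  { intros u hu.
    generalize (profile_equations J x y w N u hM hN hu); cbv zeta.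
    now rewrite (hW u 0 hu), (hlam u 0 hu). }
  (* The Codazzi equation multiplied by [U']: a linear equation for [w] as a function of [l]. *)
  assert (hode : forall l, I l ->
            w (U l) + 2 * (l + H) * Derive w (U l) * Derive U l = 0).
  { intros l hl.
    generalize (parameter_derivative J I lam U l hpar hl); intros hp.
    assert (hc : Derive lam (U l) * w (U l) +
                 2 * (lam (U l) + H) * Derive w (U l) = 0).
    { apply (codazzi_equation J w lam H); auto.
      - intros t ht; apply heq, ht.
      - intros t ht; apply heq, ht.
      - intros h0; rewrite h0 in hp; lra. }
    rewrite (hlU l hl) in hc.
    transitivity (Derive U l * (Derive lam (U l) * w (U l) +
                                2 * (l + H) * Derive w (U l)) +
                  w (U l) * (1 - Derive U l * Derive lam (U l))); [ring|].
    rewrite hc, hp; ring. }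
  assert (dw : forall t, J t -> is_derive w t (Derive w t))
    by (intros; eapply smooth_is_derive; eauto).
  assert (dU : forall l, I l -> is_derive U l (Derive U l))
    by (intros; eapply smooth_is_derive; eauto).
  assert (dcomp : forall f l, smooth_on J f -> I l ->
            is_derive (fun t => f (U t)) l (Derive f (U l) * Derive U l)).
  { intros f l hf hl; rewrite Rmult_comm.
    apply (is_derive_comp f U l); auto.
    apply (smooth_is_derive J); auto. }
  destruct (open_interval_inhabited I hI) as [l0 hl0].
  (* A first integral: its derivative is [2 w] times the left side of [hode]. The constant [c] is
     the square root of its value. *)
  set (K := fun l => w (U l) ^ 2 * (2 * (H + l))).
  assert (hK : forall l, I l -> 0 < K l).
  { intros l hl; unfold K; specialize (wpos _ (hUJ l hl)); specialize (hpos l hl).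
    apply Rmult_lt_0_compat; nra. }
  assert (hKc : forall l, I l -> K l = K l0).
  { intros l hl; apply (derive_zero_const I); auto.
    intros t ht; unfold K.
    auto_derive; [repeat split; eapply ex_derive_eta; eauto|].
    change (Derive (fun r => w r)) with (Derive w).
    change (Derive (fun r => U r)) with (Derive U).
    transitivity (2 * w (U t) *
      (w (U t) + 2 * (t + H) * Derive w (U t) * Derive U t)); [ring|].
    rewrite (hode t ht); ring. }
  set (c := sqrt (K l0)).
  assert (hc : 0 < c) by (apply sqrt_lt_R0; auto).
  exists c; split; [exact hc|].
  assert (hw : forall l, I l -> w (U l) = c / sqrt (2 * (H + l))).
  { intros l hl; unfold c; rewrite <- (hKc l hl); unfold K.
    generalize (wpos _ (hUJ l hl)) (hpos l hl); intros hw1 hl1.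
    rewrite sqrt_mult, sqrt_pow2 by nra.
    assert (0 < sqrt (2 * (H + l))) by (apply sqrt_lt_R0; lra).
    field; lra. }
  split; [exact hw|].
  intros hstand.
  split; [|split].
  { now apply (lambda_range H c l0), (hstand l0). }
  { intros l hl; now apply (lambda_range H c l), (hstand l). }
  (* A zero of [w'] would turn [hode] into [w = 0]. *)
  assert (hspeed : forall l, I l -> s (U l) * Derive w (U l) <> 0).
  { intros l hl h0.
    destruct (heq _ (hUJ l hl)) as [hs _].
    specialize (hode l hl); specialize (wpos _ (hUJ l hl)).
    assert (hw0 : Derive w (U l) = 0) by nra.
    rewrite hw0 in hode; lra. }
  destruct (nonvanishing_sign I (fun l => s (U l) * Derive w (U l)))
    as [e [he hse]]; auto.
  { intros l hl.
    assert (cU : continuous U l)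
      by (apply (ex_derive_continuous U); eexists; now apply dU).
    apply (continuous_mult (K := R_AbsRing)).
    - apply (continuous_comp U s); [exact cU|].
      now apply (profile_det_continuous J); auto.
    - apply (continuous_comp U (Derive w)); [exact cU|].
      apply (ex_derive_continuous (Derive w)); eexists.
      apply (smooth_is_derive_2 J); auto. }
  assert (he2 : e * e = 1) by (destruct he; subst; ring).
  destruct (antiderivative_exists I (phi_integrand H c) hI) as [F hF].
  { intros l hl; destruct (hstand l hl); now apply phi_integrand_continuous; auto. }
  (* The standing assumption gives [2 (H + l) - c^2 > l^2 c^2], so [w < 1] and [(x, y)] avoids the
     origin. *)
  assert (hrho : forall l, I l -> 0 < 1 - w (U l) ^ 2).
  { intros l hl; rewrite (hw l hl).
    destruct (hstand l hl) as [h1 h2]; specialize (hpos l hl).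
    unfold Rdiv; rewrite Rpow_mult_distr, pow_inv, pow2_sqrt by lra.
    fold (c ^ 2 / (2 * (H + l))).
    apply Rmult_lt_reg_r with (2 * (H + l)); [lra|].
    replace ((1 - c ^ 2 / (2 * (H + l))) * (2 * (H + l)))
      with (2 * (H + l) - c ^ 2) by (field; lra).
    nra. }
  (* The factor that scales [(x, y)] to the unit circle, where [circle_lift] applies. *)
  set (g := fun l => / sqrt (1 - w (U l) ^ 2)).
  assert (g2 : forall l, I l -> g l * g l = / (1 - w (U l) ^ 2)).
  { intros l hl; unfold g; specialize (hrho l hl).
    rewrite <- Rinv_mult, sqrt_sqrt; lra. }
  assert (dg : forall l, I l -> is_derive g l (Derive g l)).
  { intros l hl; specialize (hrho l hl); apply Derive_correct; unfold g.
    auto_derive.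
    repeat split; try (eapply ex_derive_eta; eauto); [exact hrho|].
    now apply Rgt_not_eq, sqrt_lt_R0. }
  assert (dprod : forall f l, smooth_on J f -> I l ->
            is_derive (fun t => f (U t) * g t) l
              (Derive f (U l) * Derive U l * g l + f (U l) * Derive g l)).
  { intros f l hf hl.
    apply (is_derive_mult (fun t => f (U t)) g); auto.
    intros; apply Rmult_comm. }
  destruct (circle_lift I (fun l => x (U l) * g l) (fun l => y (U l) * g l)
    (fun l => Derive x (U l) * Derive U l * g l + x (U l) * Derive g l)
    (fun l => Derive y (U l) * Derive U l * g l + y (U l) * Derive g l)
    (fun l => - e * (c ^ 2 / sqrt 2 * F l))) as [phi0 hphi]; auto.
  { intros l hl; apply dprod; [apply hM | exact hl]. }
  { intros l hl; apply dprod; [apply hM | exact hl]. }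
  { intros l hl.
    transitivity ((x (U l) ^ 2 + y (U l) ^ 2) * (g l * g l)); [ring|].
    generalize (rot2_sphere _ _ _ _ hM _ (hUJ l hl)) (hrho l hl); intros hsp hr.
    rewrite (g2 l hl).
    replace (x (U l) ^ 2 + y (U l) ^ 2) with (1 - w (U l) ^ 2) by lra.
    apply Rinv_r; lra. }
  { intros l hl.
    destruct (heq _ (hUJ l hl)) as [hs [hdet [hfr _]]].
    destruct (hstand l hl) as [h1 h2].
    rewrite (hlU l hl) in hdet, hfr.
    evar_last; [apply is_derive_scal, is_derive_scal, hF, hl|].
    (* In the angular speed of the scaled curve the terms with [g'] cancel, leaving
       [g^2 (x y' - y x') U']. *)
    transitivity (s (U l) * (l * w (U l)) * Derive U l / (1 - w (U l) ^ 2)).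
    - rewrite (angular_speed H c l (w (U l)) (Derive w (U l)) (s (U l)) e
                 (Derive U l)); auto; ring.
    - unfold Rdiv; rewrite <- (g2 l hl), <- hdet; ring. }
  (* The sign is opposite to that of [s w'], because [w] decreases in [l] and so [U'] and [w'] have
     opposite signs. *)
  exists phi0, (- e), F, (fun l => phi0 + - e * (c ^ 2 / sqrt 2 * F l)).
  split; [destruct he; subst; [now right | left; ring]|].
  split; [exact hF|].
  split; [reflexivity|].
  intros l hl; destruct (hphi l hl) as [<- <-].
  assert (0 < sqrt (1 - w (U l) ^ 2)) by (apply sqrt_lt_R0, hrho, hl).
  unfold g; split; field; lra.
Qed.
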